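(* For each $\theta_0\in\mathcal{S}$, there are infinitely many $M\in\mathbb{N}$ for which $\theta_0=\operatorname{argmin}_{\theta\in\mathcal{S}}D_M(\theta)$, where elements $\theta,\theta'$ of $\mathcal{S}$ with $\theta-\theta'\in\mathbb{Z}$ or $\theta+\theta'\in\mathbb{Z}$ are identified; that is, there are infinitely many $M\in\mathbb{N}$ such that $D_M(\theta_0)<D_M(\theta)$ for every $\theta\in\mathcal{S}$ with $\theta-\theta_0\notin\mathbb{Z}$ and $\theta+\theta_0\notin\mathbb{Z}$.
   Context: For $\theta\in\mathbb{R}$ and an integer $m\ge 0$, let $d_\theta(m)=\sup\{|I| : I\subset\mathbb{R}\text{ an interval},\ (I+\mathbb{Z})\cap\{0,\theta,2\theta,\dots,m\theta\}=\emptyset\}$, where $|I|$ is the length of $I$. $\mathbb{N}$ is the set of positive integers. Let $D(\theta)=\sup_{m\in\mathbb{N}}(m+1)\,d_\theta(m)$ and, for $M\in\mathbb{N}$, $D_M(\theta)=\max_{1\le m\le M}(m+1)\,d_\theta(m)$. Let $\mathcal{S}=\{\theta\in\mathbb{R}: D(\theta)=1+\frac{2}{\sqrt5}\}$. Note that $d_\theta(m)$ is unchanged when $\theta$ is replaced by $\pm\theta+k$ with $k\in\mathbb{Z}$. *)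

(* Defs.v *)
From HB Require Import structures.
From mathcomp Require Import all_boot all_order all_algebra.
From mathcomp Require Import all_classical all_reals all_analysis.

Set Implicit Arguments.
Unset Strict Implicit.
Unset Printing Implicit Defensive.

Import Order.TTheory GRing.Theory Num.Theory.
Import numFieldNormedType.Exports.

Local Open Scope classical_set_scope.
Local Open Scope ring_scope.

Definition multiples (R : realType) (theta : R) (m : nat) : set R :=
  [set k%:R * theta | k in [set k : nat | (k <= m)%N]].

Definition translates (R : realType) (I : set R) : set R :=
  [set x + z%:~R | x in I & z in [set: int]].

(* The length of an interval is its Lebesgue measure; intervals may be open,
   closed, half-open, degenerate or unbounded. *)
Definition dgap (R : realType) (theta : R) (m : nat) : \bar R :=
  ereal_sup [set @lebesgue_measure R I | I in
    [set I : set R | is_interval I /\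
                     translates I `&` multiples theta m = set0]].

(* Extended-real valued: the supremum is +oo for rational theta. *)
Definition Dsup (R : realType) (theta : R) : \bar R :=
  ereal_sup [set (m.+1%:R%:E * dgap theta m)%E | m in [set m : nat | (0 < m)%N]].

(* A maximum over a nonempty range as soon as 1 <= M; -oo is then neutral. *)
Definition Dmax (R : realType) (M : nat) (theta : R) : \bar R :=
  \big[maxe/-oo%E]_(1 <= m < M.+1) (m.+1%:R%:E * dgap theta m)%E.

Definition optimal_set (R : realType) : set R :=
  [set theta : R | Dsup theta = (1 + 2 / Num.sqrt 5)%:E].

(* Main.v *)
Require Import Defs.
From HB Require Import structures.
From mathcomp Require Import all_boot all_order all_algebra.
From mathcomp Require Import all_classical all_reals all_analysis.
From mathcomp Require Import zify ring lra.

Set Implicit Arguments.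
Unset Strict Implicit.
Unset Printing Implicit Defensive.

Import Order.TTheory GRing.Theory Num.Theory.
Import numFieldNormedType.Exports.

Local Open Scope classical_set_scope.
Local Open Scope ring_scope.

(** Follow [theta] down the Stern-Brocot tree: a pair of neighbouring fractions
    [p0/q0], [p1/q1] on opposite sides of [theta], with [x_i = |q_i theta - p_i|]
    and [x1 < x0], satisfies [q1 x0 + q0 x1 = 1], and the largest gap of the
    first [N] multiples is [x0] exactly for [q0 + q1 <= N < q0 + 2 q1].  Hence
    [D(theta) <= 1 + 2/sqrt 5 < 2] forces [x0 < 2 x1] as soon as [x0] is small
    (for all optimal [theta], as soon as [N >= 20]); from then on the two
    neighbours are replaced alternately, so [x1 = psi x0] with
    [psi = (sqrt 5 - 1)/2], and the denominators form a Fibonacci-like sequence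
    [Q_n].  The partial maxima then jump precisely at the indices [Q_n - 2], to
    a value [1 + 2/sqrt 5 - (1 + o(1)) x], where [1/x = a + b psi] for the
    current denominators [b], [a].  Just before a jump of [theta0], every other
    optimal [theta] has jumped more recently: the norm form
    [X^2 - X Y - Y^2] is integral and anisotropic, so two distinct pairs of
    denominators with almost equal [a + b psi] cannot exist, while equal pairs
    force [theta = +- theta0] modulo 1.  The starting denominators being
    bounded, this is uniform in [theta]. *)

(** * Gaps of the multiples modulo 1, read off Stern-Brocot neighbours *)

Section Gaps.
Variable R : realType.
Implicit Types (theta a b x mu : R) (m k : nat).

Lemma dgap_ge_free theta m a b : a < b ->
  (forall x k (z : int), a < x < b -> (k <= m)%N -> x + z%:~R <> k%:R * theta) ->
  ((b - a)%:E <= dgap theta m)%E.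
Proof.
move=> ab free; apply: ereal_sup_ubound; exists `]a, b[%classic; last first.
  by rewrite lebesgue_measure_itv /= lte_fin ab.
split; first exact: interval_is_interval.
rewrite -subset0 => y [[x xab [z _ <-]]] [k km /esym].
by apply: free => //; move: xab; rewrite /= in_itv.
Qed.

(** Given [x] in a free interval, the largest translate below [x] has another one at most [mu]
    further on; maximality puts the latter above [x], so the interval is caught between the two. *)
Lemma dgap_le_step theta m mu : 0 <= mu ->
  (forall i, (i <= m)%N -> exists i' (z : int),
     (i' <= m)%N /\ 0 < i'%:R * theta + z%:~R - i%:R * theta <= mu) ->
  (dgap theta m <= mu%:E)%E.
Proof.
move=> mu0 step; apply: ge_ereal_sup => _ [I [itvI freeI] <-].
have notI (x : R) k (z : int) : I x -> (k <= m)%N -> x <> k%:R * theta + z%:~R.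
  move=> Ix km xE.
  have : (translates I `&` multiples theta m) (k%:R * theta).
    split; last by exists k.
    by exists x => //; exists (- z) => //; rewrite xE rmorphN /= addrK.
  by rewrite freeI.
have [->|/set0P[x Ix]] := eqVneq I set0; first by rewrite measure0 lee_fin.
pose F (i : 'I_m.+1) := i%:R * theta + (Num.floor (x - i%:R * theta))%:~R.
have Fx i : F i < x.
  rewrite lt_neqAle; apply/andP; split.
    apply/eqP => FE; apply: (notI x i (Num.floor (x - i%:R * theta))) => //.
    by rewrite -ltnS.
  by rewrite /F; have := floor_le (x - i%:R * theta); lra.
have [i _ /= Fmax] := arg_maxP F (erefl : xpredT (@ord0 m)).
have im : (i <= m)%N by rewrite -ltnS.
have [i' [z [i'm /andP[step0 stepmu]]]] := step i im.
set p := F i; set z' := z + Num.floor (x - i%:R * theta).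
set p' := i'%:R * theta + z'%:~R.
have p'E : p' - p = i'%:R * theta + z%:~R - i%:R * theta.
  by rewrite /p' /p /F /z' rmorphD /=; ring.
have xp' : x < p'.
  rewrite ltNge; apply/negP => p'x.
  have /= := Fmax (Ordinal (i'm : (i' < m.+1)%N)) erefl.
  have zf : (z' <= Num.floor (x - i'%:R * theta)).
    by rewrite floor_ge_int; move: p'x; rewrite /p'; lra.
  have : z'%:~R <= (Num.floor (x - i'%:R * theta))%:~R :> R by rewrite ler_int.
  by move: p'E; rewrite /p' /p /F /=; lra.
have Isub : I `<=` `]p, p'[%classic.
  move=> y Iy; rewrite /= in_itv /=; apply/andP; split; rewrite ltNge; apply/negP => le.
    by apply: (notI p i (Num.floor (x - i%:R * theta))) => //; apply: (itvI y x); rewrite // le ltW // Fx.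
  by apply: (notI p' i' z') => //; apply: (itvI x y); rewrite // le ltW.
have mI : measurable (I : set (measurableTypeR R)).
  exact: measurable_realfun.is_interval_measurable.
have mp : measurable (`]p, p'[%classic : set (measurableTypeR R)).
  exact: measurable_itv.
have mle : (lebesgue_measure (`]p, p'[%classic : set R) <= mu%:E)%E.
  by rewrite lebesgue_measure_itv /= lte_fin; case: ifP => _; rewrite lee_fin // p'E.
by apply: le_trans mle; apply: le_measure; rewrite ?inE.
Qed.

Lemma dgap_rational (theta : R) (s : nat) m : (0 < s)%N ->
  s%:R * theta \is a Num.int -> ((s%:R^-1)%:E <= dgap theta m)%E.
Proof.
move=> s0 /intrP[p pE]; have s0R : 0 < s%:R :> R by rewrite ltr0n.
rewrite -[s%:R^-1]subr0; apply: dgap_ge_free; first by rewrite invr_gt0.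
move=> x k z /andP[x0 xs] _ xE.
have : s%:R * x = (k%:Z * p - s%:Z * z)%:~R.
  rewrite rmorphB /= !rmorphM /= -pE /=.
  have -> : x = k%:R * theta - z%:~R by lra.
  by rewrite -!pmulrn; ring.
move: (_ - _) => t tE.
have : 0 < s%:R * x by rewrite mulr_gt0.
have : s%:R * x < 1.
  by rewrite -(ltr_pM2l s0R) divff ?lt0r_neq0 // in xs.
by rewrite tE ltr0z ltrz1; lia.
Qed.

(* Two neighbours of [theta] in the Stern-Brocot tree, on opposite sides of it:
   [x0] and [x1] are the distances to the nearest integer of [q0 theta] and
   [q1 theta], and [e] is the sign of [q0 theta - p0]. *)
Record bracket theta (q0 q1 : nat) (p0 p1 e : int) (x0 x1 : R) : Prop := Bracket {
  bracket_sign : e = 1 \/ e = -1;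
  bracket_x0 : x0 = e%:~R * (q0%:R * theta - p0%:~R);
  bracket_x1 : x1 = e%:~R * (p1%:~R - q1%:R * theta);
  bracket_gt0 : 0 < x0;
  bracket_gt1 : 0 < x1;
  bracket_pos : (0 < q1)%N;
  bracket_det : q0%:Z * p1 - q1%:Z * p0 = e }.

Lemma bracket_sum theta q0 q1 p0 p1 e x0 x1 :
  bracket theta q0 q1 p0 p1 e x0 x1 -> q1%:R * x0 + q0%:R * x1 = 1.
Proof.
move=> [es -> -> _ _ _ /(congr1 (fun z : int => z%:~R : R))].
rewrite rmorphB /= !rmorphM /= -!pmulrn => detE.
have -> : q1%:R * (e%:~R * (q0%:R * theta - p0%:~R)) +
  q0%:R * (e%:~R * (p1%:~R - q1%:R * theta)) =
  e%:~R * (q0%:R * p1%:~R - q1%:R * p0%:~R) by ring.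
by rewrite detE -rmorphM; case: es => ->.
Qed.

(** As the determinant is [e = +-1], Cramer's rule gives [(s, t)] integer coordinates in the basis
    [(q1, p1)], [(q0, p0)]. *)
Lemma bracket_basis theta q0 q1 p0 p1 e x0 x1 (s t : int) :
  bracket theta q0 q1 p0 p1 e x0 x1 -> exists a b : int,
    s = a * q1%:Z + b * q0%:Z /\
    s%:~R * theta - t%:~R = e%:~R * (b%:~R * x0 - a%:~R * x1).
Proof.
move=> [es x0E x1E _ _ _ detE].
have ee : e * e = 1 by case: es => ->.
have eeR : e%:~R * e%:~R = 1 :> R by rewrite -rmorphM /= ee.
pose a := e * (q0%:Z * t - p0 * s); pose b := e * (s * p1 - t * q1%:Z).
have sE : s = a * q1%:Z + b * q0%:Z.
  transitivity (e * s * (q0%:Z * p1 - q1%:Z * p0)); first by rewrite detE mulrAC ee mul1r.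
  by rewrite /a /b; ring.
have tE : t = a * p1 + b * p0.
  transitivity (e * t * (q0%:Z * p1 - q1%:Z * p0)); first by rewrite detE mulrAC ee mul1r.
  by rewrite /a /b; ring.
exists a, b; split=> //; clearbody a b.
rewrite x0E x1E sE tE !rmorphD /= !rmorphM /= -!pmulrn.
transitivity (e%:~R * e%:~R * ((a%:~R * q1%:R + b%:~R * q0%:R) * theta -
  (a%:~R * p1%:~R + b%:~R * p0%:~R))); first by rewrite eeR mul1r.
by ring.
Qed.

(* The gap starting at the point with index [q1 - 1]. *)
Lemma bracket_dgap_ge theta q0 q1 p0 p1 e x0 x1 m :
  bracket theta q0 q1 p0 p1 e x0 x1 -> (m + 2 <= q0 + 2 * q1)%N ->
  (x0%:E <= dgap theta m)%E.
Proof.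
move=> br mq; have [es _ _ x0gt x1gt q1gt _] := br.
(* A displacement in []0, x0[] forces [a >= 1] if [b >= 1], and [a <= -1] if [b <= 0]. Seen from
   index [q1 - 1], the other index is then negative or beyond [m]. *)
have key (s t : int) : 0 < e%:~R * (s%:~R * theta - t%:~R) < x0 ->
    s <= - q1%:Z \/ q0%:Z + q1%:Z <= s.
  have [a [b [sE ->]]] := bracket_basis s t br.
  rewrite mulrA -rmorphM /= (_ : e * e = 1) ?mul1r; last by case: es => ->.
  move=> /andP[gt lt]; have [b1|b0] : 1 <= b \/ b <= 0 by lia.
    right; suff : 1 <= a by rewrite sE; nia.
    have b1R : 1 <= b%:~R :> R by rewrite ler1z.
    by rewrite -gtz0_ge1 -(ltr0z R) -(pmulr_lgt0 _ x1gt); nra.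
  left; suff : a <= -1 by rewrite sE; nia.
  have b0R : b%:~R <= 0 :> R by rewrite lerz0.
  suff : a < 0 by lia.
  by rewrite -(ltrz0 R) -(pmulr_llt0 _ x1gt); nra.
have free (x : R) k (z : int) : 0 < e%:~R * (x - (q1 - 1)%:R * theta) < x0 ->
    (k <= m)%N -> x + z%:~R <> k%:R * theta.
  move=> xI km xE; have := key (k%:Z - (q1 - 1)%:Z) z.
  rewrite rmorphB /= -!pmulrn.
  have -> : (k%:R - (q1 - 1)%:R) * theta - z%:~R = x - (q1 - 1)%:R * theta by lra.
  by move=> /(_ xI); lia.
set c := (q1 - 1)%:R * theta in free.
case: es => ee; rewrite ee in free.
  have -> : x0 = c + x0 - c by ring.
  by apply: dgap_ge_free => [|x k z xI]; [lra|apply: free; rewrite mul1r; lra].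
have -> : x0 = c - (c - x0) by ring.
by apply: dgap_ge_free => [|x k z xI]; [lra|apply: free; rewrite mulrN1z mulN1r; lra].
Qed.

(** For [e = 1], adding [q0] to an index moves the point up by [x0], subtracting [q1] moves it up by
    [x1]; with at least [q0 + q1] points, one of the two stays in range. For [e = -1] the roles are
    exchanged. *)
Lemma bracket_dgap_le theta q0 q1 p0 p1 e x0 x1 m :
  bracket theta q0 q1 p0 p1 e x0 x1 -> x1 <= x0 -> (q0 + q1 <= m.+1)%N ->
  (dgap theta m <= x0%:E)%E.
Proof.
move=> [es x0E x1E x0gt x1gt q1gt detE] x10 qm.
apply: dgap_le_step => [|i im]; first exact: ltW.
case: es => ee; rewrite ee ?mulrN1z ?mulr1z in x0E x1E.
  have [iq|iq] := ltnP i q1.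
    exists (i + q0)%N, (- p0); split; first by lia.
    by rewrite rmorphN natrD /=; lra.
  exists (i - q1)%N, p1; split; first by lia.
  by rewrite natrB //; lra.
have [iq|iq] := ltnP i q0.
  exists (i + q1)%N, (- p1); split; first by lia.
  by rewrite rmorphN natrD /=; lra.
exists (i - q0)%N, p0; split; first by lia.
by rewrite natrB //; lra.
Qed.

End Gaps.

(** * Optimal numbers and the golden ratio *)

Section Golden.
Variable R : realType.
Implicit Types (theta x : R) (q m n : nat).

(** Locked, so that arithmetic tactics treat it as an atom. *)
Definition psi : R := locked ((Num.sqrt 5 - 1) / 2).

Lemma psi_sqr : psi * psi = 1 - psi.
Proof.
have : Num.sqrt 5 ^+ 2 = 5 :> R by rewrite sqr_sqrtr.
by rewrite /psi -lock expr2; lra.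
Qed.

Lemma psi_bounds : 21 / 34 < psi < 34 / 55.
Proof.
have s0 : 0 <= Num.sqrt 5 :> R by exact: sqrtr_ge0.
have : Num.sqrt 5 ^+ 2 = 5 :> R by rewrite sqr_sqrtr.
by rewrite /psi -lock expr2 => s5; apply/andP; split; nra.
Qed.

Lemma optimal_valueE : 1 + 2 / Num.sqrt 5 = (7 + 4 * psi) / 5 :> R.
Proof.
have s0 : 0 < Num.sqrt 5 :> R by rewrite sqrtr_gt0.
have s5 : Num.sqrt 5 ^+ 2 = 5 :> R by rewrite sqr_sqrtr.
have -> : 2 / Num.sqrt 5 = 2 / 5 * Num.sqrt 5 :> R.
  by rewrite -{2}s5; field; rewrite lt0r_neq0.
by rewrite /psi -lock; field.
Qed.

Lemma psi_expr_le n : psi ^+ n * (1 + n%:R * psi) <= 1.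
Proof.
have := psi_bounds; have := psi_sqr; move=> pp /andP[p0 p1].
elim: n => [|n IHn]; first by rewrite mul0r addr0 mulr1.
apply: le_trans IHn; rewrite exprSr -mulrA ler_wpM2l ?exprn_ge0 //; first lra.
by rewrite -[n.+1]addn1 natrD; have := ler0n R n; nra.
Qed.

Lemma psi_expr_small (a c : R) : (forall n, a <= c * psi ^+ n) -> a <= 0.
Proof.
move=> ac; rewrite leNgt; apply/negP => a0.
have := psi_bounds => /andP[p0 p1].
have c0 : 0 < c by have := ac 0%N; rewrite expr0 mulr1; lra.
have [n nE] : exists n, 2 * c / a < n%:R.
  by exists (Num.bound (2 * c / a)); apply: archi_boundP; rewrite divr_ge0 //; lra.
have := ac n; have := psi_expr_le n.
have pn : 0 < psi ^+ n by rewrite exprn_gt0 //; lra.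
have : 2 * c < n%:R * a by rewrite -ltr_pdivrMr.
have n0 := ler0n R n; move: (psi ^+ n) (n%:R) n0 pn => u v v0 u0 va uv au.
have uv2 : u * v <= 2 by nra.
have := ler_wpM2l v0 au; have := ler_wpM2l (ltW c0) uv2; lra.
Qed.

Definition irrational_mul theta := forall s, (0 < s)%N -> s%:R * theta \isn't a Num.int.

(** Here and in [bracket_keep] the mediant replaces [p0/q0]; this form also exchanges the
    neighbours, as suits [x0 < 2 * x1], when the mediant has the smaller distance. *)
Lemma bracket_flip theta q0 q1 p0 p1 e x0 x1 :
  bracket theta q0 q1 p0 p1 e x0 x1 -> x1 < x0 ->
  bracket theta q1 (q0 + q1) p1 (p0 + p1) (- e) x1 (x0 - x1).
Proof.
move=> [es x0E x1E x0gt x1gt q1gt detE] x10; split => //.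
- by case: es => ->; [right | left; rewrite opprK].
- by rewrite x1E rmorphN /=; ring.
- by rewrite x0E x1E natrD rmorphN rmorphD /=; ring.
- by rewrite subr_gt0.
- by lia.
- by rewrite -detE; lia.
Qed.

Lemma bracket_keep theta q0 q1 p0 p1 e x0 x1 :
  bracket theta q0 q1 p0 p1 e x0 x1 -> x1 < x0 ->
  bracket theta (q0 + q1) q1 (p0 + p1) p1 e (x0 - x1) x1.
Proof.
move=> [es x0E x1E x0gt x1gt q1gt detE] x10; split => //.
- by rewrite x0E x1E natrD rmorphD /=; ring.
- by rewrite subr_gt0.
- by rewrite -detE; lia.
Qed.

Lemma exists_bracket theta N : irrational_mul theta -> (0 < N)%N ->
  exists q0 q1 p0 p1 e x0 x1, [/\ bracket theta q0 q1 p0 p1 e x0 x1,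
    x1 < x0 & (q0 + q1 <= N < q0 + 2 * q1)%N].
Proof.
move=> irr; case: N => // N _; elim: N => [|N].
  set f := Num.floor theta.
  have fE := floorD1_gt theta; have fle := floor_le theta; rewrite rmorphD /= in fE.
  have fneq : f%:~R != theta.
    apply/eqP => fT; have /negP := irr 1%N erefl; rewrite mul1r -fT.
    by apply; exact: intr_int.
  have flt : f%:~R < theta by rewrite lt_neqAle fneq.
  (* The formal fraction [-1/0] starts the descent: [x0 = 1] is the gap left by a single point. *)
  exists 0%N, 1%N, (-1), (f + 1), 1, 1, ((f + 1)%:~R - theta).
  rewrite rmorphD /=; split=> //; last by rewrite -/f in fE; lra.
  split=> //; rewrite ?rmorphD /= -/f in fE *; first by left.
  - by rewrite mul0r mulrN1z; ring.
  - by ring.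
  - by lra.
  - by lia.
move=> [q0 [q1 [p0 [p1 [e [x0 [x1 [br x10 /andP[qN Nq]]]]]]]]].
have q1gt := bracket_pos br.
have [lt|le] := ltnP N.+2 (q0 + 2 * q1).
  by exists q0, q1, p0, p1, e, x0, x1; split=> //; lia.
have neq : x0 - x1 != x1.
  apply/eqP => xE; have /negP := irr (q0 + 2 * q1)%N (ltac:(lia)); apply.
  apply/intrP; exists (p0 + 2 * p1).
  have : x0 - 2 * x1 = 0 by lra.
  rewrite (bracket_x0 br) (bracket_x1 br) natrD natrM rmorphD rmorphM /=.
  by case: (bracket_sign br) => ->; rewrite ?mulrN1z ?mulr1z; lra.
have := bracket_keep br x10; have := bracket_flip br x10.
have [lt|gt|/eqP] := ltgtP (x0 - x1) x1; last by rewrite (negPf neq).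
  move=> br' _; exists q1, (q0 + q1)%N, p1, (p0 + p1), (- e), x1, (x0 - x1).
  by split=> //; lia.
move=> _ br'; exists (q0 + q1)%N, q1, (p0 + p1), p1, e, (x0 - x1), x1.
by split=> //; lia.
Qed.

Lemma optimal_le theta m : optimal_set theta -> (0 < m)%N ->
  (m.+1%:R%:E * dgap theta m <= ((7 + 4 * psi) / 5)%:E)%E.
Proof.
rewrite -optimal_valueE => <- m0; apply: ereal_sup_ubound.
by exists m.
Qed.

Lemma optimal_dgap_le theta m (x : R) : optimal_set theta -> (0 < m)%N ->
  (x%:E <= dgap theta m)%E -> m.+1%:R * x <= (7 + 4 * psi) / 5.
Proof.
move=> opt m0 xd; rewrite -lee_fin EFinM; apply: le_trans (optimal_le opt m0).
by apply: lee_wpmul2l; rewrite ?lee_fin.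
Qed.

Lemma optimal_irrational theta : optimal_set theta -> irrational_mul theta.
Proof.
move=> opt s s0; apply/negP => sint.
(* Index [2 * s] already gives [(2 s + 1) / s > 2], above the optimal value. *)
have := optimal_dgap_le opt _ (dgap_rational (2 * s) s0 sint).
move=> /(_ _)/wrap[]; first by lia.
rewrite -[(2 * s).+1]addn1 natrD natrM mulrDl mul1r -mulrA divff ?pnatr_eq0 -?lt0n //.
have : 0 < s%:R^-1 :> R by rewrite invr_gt0 ltr0n.
by have /andP[] := psi_bounds; move: (s%:R^-1) => r; lra.
Qed.

Lemma optimal_bracket_le theta q0 q1 p0 p1 e x0 x1 :
  optimal_set theta -> bracket theta q0 q1 p0 p1 e x0 x1 ->
  (3 <= q0 + 2 * q1)%N -> (q0%:R + 2 * q1%:R - 1) * x0 <= (7 + 4 * psi) / 5.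
Proof.
move=> opt br q3.
have := optimal_dgap_le opt _ (bracket_dgap_ge br (_ : q0 + 2 * q1 - 2 + 2 <= _)%N).
move=> /(_ _ _)/wrap[||]; [by lia|by lia|].
have -> : (q0 + 2 * q1 - 2).+1 = (q0 + 2 * q1 - 1)%N by lia.
rewrite natrB; last lia.
by rewrite natrD natrM.
Qed.

(* Had [x0] been at least [2 x1], the determinant relation would give
   [(q0 + 2 q1) x0 >= 2], beyond the optimal value up to the error [x0]. *)
Lemma optimal_bracket_flip theta q0 q1 p0 p1 e x0 x1 :
  optimal_set theta -> bracket theta q0 q1 p0 p1 e x0 x1 ->
  x0 < (3 - 4 * psi) / 5 -> x0 < 2 * x1.
Proof.
move=> opt br x0lt; rewrite ltNge; apply/negP => x01.
have pb := psi_bounds; have sumE := bracket_sum br.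
have q00 := ler0n R q0; have q10 := ler0n R q1; have x0gt := bracket_gt0 br.
have ge2 : 2 <= (q0%:R + 2 * q1%:R) * x0 by nra.
have q3 : (3 <= q0 + 2 * q1)%N.
  by rewrite -(ler_nat R) natrD natrM; nra.
by have := optimal_bracket_le opt br q3; lra.
Qed.

(** A flip multiplies the error [psi x0 - x1] by [-(1 + psi) = -1/psi] while the distances decrease,
    so the crude bound after [n] flips, pulled back, gains a factor [psi^n]. *)
Lemma optimal_bracket_ratio theta n : optimal_set theta ->
  forall q0 q1 p0 p1 e x0 x1, bracket theta q0 q1 p0 p1 e x0 x1 ->
  x1 < x0 -> x0 < (3 - 4 * psi) / 5 -> `|psi * x0 - x1| <= x0 * psi ^+ n.
Proof.
move=> opt; have := psi_bounds; have pp := psi_sqr; move=> /andP[p0' p1'].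
elim: n => [|n IHn] q0 q1 p0 p1 e x0 x1 br x10 x0lt.
  by rewrite expr0 mulr1 ler_norml; have := bracket_gt1 br; nra.
have x01 := optimal_bracket_flip opt br x0lt.
have := IHn _ _ _ _ _ _ _ (bracket_flip br x10) _ _.
move=> /(_ _ _)/wrap[||]; [by lra|by lra|].
have -> : psi * x1 - (x0 - x1) = - (1 + psi) * (psi * x0 - x1).
  have : psi * psi * x0 = (1 - psi) * x0 by rewrite pp.
  by lra.
have psi1 : 0 <= 1 + psi by lra.
rewrite normrM normrN (ger0_norm psi1).
have pn : 0 < psi ^+ n by rewrite exprn_gt0 //; lra.
rewrite exprS; have := normr_ge0 (psi * x0 - x1).
move: `|_| (psi ^+ n) pn => u v v0 u0 le.
have : psi * ((1 + psi) * u) <= psi * (x1 * v) by rewrite ler_pM2l //; lra.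
have -> : psi * ((1 + psi) * u) = u by rewrite mulrA mulrDr mulr1 pp [psi + _]addrC subrK mul1r.
move=> /le_trans; apply; rewrite mulrCA ler_pM2r; first by lra.
by rewrite mulr_gt0 //; lra.
Qed.

Definition golden theta q0 q1 x :=
  exists p0 p1 e, bracket theta q0 q1 p0 p1 e x (psi * x).

Lemma golden_gt0 theta q0 q1 x : golden theta q0 q1 x -> 0 < x.
Proof. by move=> [p0 [p1 [e br]]]; exact: bracket_gt0 br. Qed.

Lemma golden_pos theta q0 q1 x : golden theta q0 q1 x -> (0 < q1)%N.
Proof. by move=> [p0 [p1 [e br]]]; exact: bracket_pos br. Qed.

Lemma golden_sum theta q0 q1 x : golden theta q0 q1 x ->
  (q1%:R + q0%:R * psi) * x = 1.
Proof. by move=> [p0 [p1 [e br]]]; have := bracket_sum br; lra. Qed.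

Lemma golden_next theta q0 q1 x : golden theta q0 q1 x ->
  golden theta q1 (q0 + q1) (psi * x).
Proof.
move=> gd; have x0 := golden_gt0 gd; have pb := psi_bounds.
case: gd => [p0 [p1 [e br]]]; exists p1, (p0 + p1), (- e).
have -> : psi * (psi * x) = x - psi * x by rewrite mulrA psi_sqr; ring.
by apply: bracket_flip => //; nra.
Qed.

Lemma golden_dgap theta q0 q1 x m : golden theta q0 q1 x ->
  (q0 + q1 <= m.+1)%N -> (m.+1 < q0 + 2 * q1)%N -> dgap theta m = x%:E.
Proof.
move=> gd qm mq; have x0 := golden_gt0 gd; have pb := psi_bounds.
case: gd => [p0 [p1 [e br]]]; apply/eqP; rewrite eq_le; apply/andP; split.
  by apply: bracket_dgap_le br _ qm; nra.
by apply: bracket_dgap_ge br _; lia.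
Qed.

Lemma optimal_golden theta : optimal_set theta ->
  exists q0 q1 x, golden theta q0 q1 x /\ (q0 + q1 <= 20 < q0 + 2 * q1)%N.
Proof.
move=> opt; have pb := psi_bounds; have pp := psi_sqr.
have [q0 [q1 [p0 [p1 [e [x0 [x1 [br x10 /andP[qN Nq]]]]]]]]] :=
  exists_bracket (optimal_irrational opt) (isT : (0 < 20)%N).
have xgt := bracket_gt0 br.
(* Since [q0 + 2 q1 >= 21], [20 x0] is at most the optimal value, so [x0 < 0.095]; the threshold
   exceeds [0.105]. *)
have xlt : x0 < (3 - 4 * psi) / 5.
  have := optimal_bracket_le opt br _; move=> /(_ _)/wrap[]; first by lia.
  have : 21%:R <= (q0 + 2 * q1)%:R :> R by rewrite ler_nat.
  by rewrite natrD natrM; nra.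
exists q0, q1, x0; split; last by rewrite qN.
exists p0, p1, e; suff -> : psi * x0 = x1 by [].
apply/eqP; rewrite -subr_eq0 -normr_le0.
by apply: (@psi_expr_small _ x0) => n; exact: (optimal_bracket_ratio n opt br).
Qed.

End Golden.

(** * The norm form, and strictness of the optimal bound *)

Section Norm.
Variable R : realType.
Implicit Types (theta x K : R).
Local Notation psi := (psi R).

(** Completing the square gives [(2a - b)^2 = 5 b^2], impossible for [b <> 0] by parity of the
    5-adic valuation. *)
Lemma golden_norm_eq0 (a b : int) : a * a - a * b - b * b = 0 -> a = 0 /\ b = 0.
Proof.
move=> ab; suff b0 : b = 0 by move: ab; rewrite b0; nia.
apply/eqP; rewrite -absz_eq0 -leqn0 leqNgt; apply/negP => n0.
have : (absz (2%:Z * a - b)%R * absz (2%:Z * a - b)%R = 5 * (absz b * absz b))%N by nia.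
move: (absz (2%:Z * a - b)%R) `|b|%N n0 => c n n0 cE.
have c0 : (0 < c)%N by nia.
have := congr1 (logn 5) cE; rewrite !lognM ?muln_gt0 ?n0 //.
by rewrite (pfactorK 1 (isT : prime 5)); lia.
Qed.

Lemma golden_normE (a b : int) :
  (a%:~R + b%:~R * psi) * (a%:~R - (1 + psi) * b%:~R) = (a * a - a * b - b * b)%:~R.
Proof.
rewrite !rmorphB /= !rmorphM /=.
have : psi * psi * (b%:~R * b%:~R) = (1 - psi) * (b%:~R * b%:~R) by rewrite psi_sqr.
by lra.
Qed.

Lemma psi_free (a b : int) : a%:~R + b%:~R * psi = 0 -> a = 0 /\ b = 0.
Proof.
move=> ab; apply: golden_norm_eq0; apply/eqP.
by rewrite -(intr_eq0 R) -golden_normE ab mul0r.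
Qed.

(* Multiplying by [sqrt 5 = 1 + 2 psi] and comparing coordinates in the basis
   [1, psi] shows that [N] divides the coprime integers [q0] and [q1]. *)
Lemma golden_value_neq theta q0 q1 x (u v : int) N : golden theta q0 q1 x ->
  (1 < N)%N -> N%:R * (u%:~R * theta - v%:~R) <> (7 + 4 * psi) / 5.
Proof.
move=> gd N1; have sumE := golden_sum gd; case: gd => [p0 [p1 [e br]]] valE.
have detE := bracket_det br; have pp := psi_sqr R.
have [a [b [_ linE]]] := bracket_basis u v br.
have {}linE : u%:~R * theta - v%:~R = e%:~R * (b%:~R - a%:~R * psi) * x.
  by rewrite linE; ring.
have := congr1 (fun y => (1 + 2 * psi) * (q1%:R + q0%:R * psi) * y) valE.
rewrite linE.
have -> : (1 + 2 * psi) * (q1%:R + q0%:R * psi) *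
    (N%:R * (e%:~R * (b%:~R - a%:~R * psi) * x)) =
    (1 + 2 * psi) * N%:R * (e%:~R * (b%:~R - a%:~R * psi)) *
    ((q1%:R + q0%:R * psi) * x) by ring.
rewrite sumE mulr1 => {}valE.
have := @psi_free (N%:Z * (e * (b - 2 * a)) - (3 * q1%:Z + 2 * q0%:Z))
                  (N%:Z * (e * (2 * b + a)) - (2 * q1%:Z + q0%:Z)).
rewrite !(rmorphB, rmorphD, rmorphM) /= -!pmulrn => /(_ _)/wrap[].
  have ppz (z : R) : psi * psi * z = z - psi * z by rewrite pp mulrBl mul1r.
  have := ppz (N%:R * (e%:~R * a%:~R)); have := ppz q1%:R; have := ppz q0%:R.
  have := ppz (psi * q0%:R).
  by lra.
move: (e * (b - 2 * a)) (e * (2 * b + a)) => A B [AE BE].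
have q1E : q1%:Z = N%:Z * (2 * B - A) by lia.
have q0E : q0%:Z = N%:Z * (2 * A - 3 * B) by lia.
have : (N%:Z %| e)%Z.
  apply/dvdzP; exists ((2 * A - 3 * B) * p1 - (2 * B - A) * p0).
  by rewrite -detE q1E q0E; ring.
rewrite dvdzE; case: (bracket_sign br) => -> /=; by rewrite dvdn1 => /eqP NE; rewrite NE in N1.
Qed.

(** The optimal value is never attained: the gap has the form [u theta - v] with integers [u], [v],
    and [golden_value_neq] applies. *)
Lemma optimal_strict theta m : optimal_set theta -> (0 < m)%N ->
  exists d : R, dgap theta m = d%:E /\ m.+1%:R * d < (7 + 4 * psi) / 5.
Proof.
move=> opt m0.
have [q0 [q1 [p0 [p1 [e [x0 [x1 [br x10 /andP[qN Nq]]]]]]]]] :=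
  exists_bracket (optimal_irrational opt) (isT : (0 < m.+1)%N).
have ge := bracket_dgap_ge br (ltac:(lia) : (m + 2 <= q0 + 2 * q1)%N).
exists x0; split.
  by apply/eqP; rewrite eq_le ge (bracket_dgap_le br (ltW x10)).
rewrite lt_neqAle (optimal_dgap_le opt m0 ge) andbT; apply/eqP.
have [r0 [r1 [x [gd _]]]] := optimal_golden opt.
have -> : x0 = (e * q0%:Z)%:~R * theta - (e * p0)%:~R.
  by rewrite (bracket_x0 br) !rmorphM /= -!pmulrn; ring.
exact: golden_value_neq gd _.
Qed.

Lemma optimal_strict_unif theta n : optimal_set theta -> exists2 eps : R, 0 < eps &
  forall m, (0 < m < n)%N ->
    (m.+1%:R%:E * dgap theta m <= ((7 + 4 * psi) / 5 - eps)%:E)%E.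
Proof.
move=> opt; elim: n => [|n [eps eps0 IHn]]; first by exists 1 => // m; rewrite andbF.
case: n IHn => [|n] IHn; first by exists 1 => // m; lia.
have [d [dE dlt]] := optimal_strict opt (isT : (0 < n.+1)%N).
exists (Num.min eps ((7 + 4 * psi) / 5 - n.+2%:R * d)).
  by rewrite lt_min eps0 subr_gt0.
move=> m /andP[m0]; rewrite ltnS leq_eqVlt => /predU1P[->|mn].
  rewrite dE -EFinM lee_fin lerBrDl -lerBrDr.
  by rewrite ge_min lexx orbT.
apply: le_trans (IHn m _) _; first by rewrite m0.
by rewrite lee_fin lerD2l lerN2 ge_min lexx.
Qed.

End Norm.

(** * Fibonacci-like denominators and the levels of the partial maxima *)

Fixpoint fib (a b n : nat) : nat :=
  if n is n'.+1 then fib b (a + b) n' else a.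

Lemma fibSS a b n : fib a b n.+2 = (fib a b n + fib a b n.+1)%N.
Proof. by elim: n a b => [|n IHn] a b //=; rewrite -IHn. Qed.

Lemma fib_gt0 a b n : (0 < b)%N -> (0 < fib a b n.+1)%N.
Proof. by elim: n a b => [|n IHn] a b b0 //; apply: (IHn b); rewrite addn_gt0 b0 orbT. Qed.

Lemma fib_ge a b n : (0 < b)%N -> (n <= fib a b n.+1)%N.
Proof.
move=> b0; elim: n => [|n IHn] //; case: n IHn => [|n] IHn; first exact: (fib_gt0 a 1).
by rewrite fibSS; have := fib_gt0 a n b0; lia.
Qed.

Section Levels.
Variable R : realType.
Implicit Types (theta x K : R) (a b m n : nat).
Local Notation psi := (psi R).

(** [a - (1 + psi) b] is the conjugate of [1/x = a + b psi]. A step multiplies it by [-psi] and [x]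
    by [psi], so one [K] serves the whole sequence. *)
Definition tame theta K b a x :=
  golden theta b a x /\ `|a%:R - (1 + psi) * b%:R| <= K * x.

Lemma tame_next theta K b a x : tame theta K b a x -> tame theta K a (b + a) (psi * x).
Proof.
move=> [gd le]; split; first exact: golden_next.
have /andP[pl pu] := psi_bounds R; have pp := psi_sqr R.
have -> : (b + a)%:R - (1 + psi) * a%:R = - psi * (a%:R - (1 + psi) * b%:R).
  have : psi * psi * b%:R = (1 - psi) * b%:R by rewrite pp.
  by rewrite natrD; lra.
have psi0 : 0 < psi by lra.
by rewrite normrM normrN (gtr0_norm psi0) mulrCA ler_pM2l.
Qed.

Lemma tame_fib theta K b a x n : tame theta K b a x ->
  tame theta K (fib b a n) (fib b a n.+1) (psi ^+ n * x).
Proof.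
elim: n b a x => [|n IHn] b a x tm; first by rewrite expr0 mul1r.
by rewrite exprSr -mulrA; exact: IHn (tame_next tm).
Qed.

Lemma optimal_tame : exists2 K : R, 1 <= K & forall theta, optimal_set theta ->
  exists q0 q1 x, tame theta K q0 q1 x /\ (q0 + q1 <= 20 < q0 + 2 * q1)%N.
Proof.
(* Denominators at most 20 make the conjugate at most 40 in absolute value and [1/x] at most 20. *)
exists 800 => [|theta opt]; first by lra.
have [q0 [q1 [x [gd q20]]]] := optimal_golden opt.
exists q0, q1, x; split=> //; split=> //; move: q20 => /andP[q20 _].
have /andP[pl pu] := psi_bounds R; have x0 := golden_gt0 gd.
have q00 := ler0n R q0; have q10 := ler0n R q1.
have : (q0 + q1)%:R <= 20%:R :> R by rewrite ler_nat.
rewrite natrD => qR; have sumE := golden_sum gd.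
have W20 : q1%:R + q0%:R * psi <= 20 by nra.
have := ler_wpM2r (ltW x0) W20; rewrite sumE => x20.
by rewrite ler_norml; apply/andP; split; nra.
Qed.

(* Scaling factor times largest gap at the last index where the gap is [x]. *)
Definition level b a x : R := (b%:R + 2 * a%:R - 1) * x.

(** Expand [b + 2 a] on [a + b psi] and its conjugate, with coefficients [(7 + 4 psi)/5] and
    [(3 - 4 psi)/5], and use [golden_sum]. *)
Lemma levelE theta b a x : golden theta b a x ->
  level b a x = (7 + 4 * psi) / 5 -
    (1 - (3 - 4 * psi) / 5 * (a%:R - (1 + psi) * b%:R)) * x.
Proof.
move=> gd; have sumE := golden_sum gd.
have : (7 + 4 * psi) / 5 * ((a%:R + b%:R * psi) * x) = (7 + 4 * psi) / 5.
  by rewrite sumE mulr1.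
have : psi * psi * (b%:R * x) = (1 - psi) * (b%:R * x) by rewrite psi_sqr.
by rewrite /level; lra.
Qed.

(** The conjugate is at most [1/2], so the deficit to the optimal value is close to [x] and shrinks
    with it. *)
Lemma level_fib_ge theta K b a x n : tame theta K b a x -> 2 * K * x <= 1 ->
  level b a x <= level (fib b a n) (fib b a n.+1) (psi ^+ n * x).
Proof.
have /andP[pl pu] := psi_bounds R; have pp := psi_sqr R.
elim: n b a x => [|n IHn] b a x tm Kx; first by rewrite expr0 mul1r.
have tm' := tame_next tm; have [gd Vle] := tm; have x0 := golden_gt0 gd.
have [gd' Vle'] := tm'.
apply: (@le_trans _ _ (level a (b + a) (psi * x))); last first.
  rewrite exprSr -mulrA; apply: IHn tm' _; nra.
rewrite (levelE gd) (levelE gd') lerD2l lerN2 mulrA ler_pM2r //.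
have V1 : `|a%:R - (1 + psi) * b%:R| <= 1 / 2 by lra.
have V2 : `|(b + a)%:R - (1 + psi) * a%:R| <= 1 / 2 by nra.
move: V1 V2; rewrite !ler_norml.
move: (_ - _) (_ - _) => V V' /andP[V1 V2] /andP[V3 V4].
by nra.
Qed.

(** The level after the [n]-th is reached at index [fib b a n.+4 - 2]; the bound on [m] stops just
    short of it. *)
Lemma dgap_le_level theta K b a x n m : tame theta K b a x -> 2 * K * x <= 1 ->
  (b + a <= m.+1)%N -> (m.+2 < fib b a n.+4)%N ->
  (m.+1%:R%:E * dgap theta m <=
    (level (fib b a n) (fib b a n.+1) (psi ^+ n * x))%:E)%E.
Proof.
have /andP[pl pu] := psi_bounds R; have pp := psi_sqr R.
elim: n b a x => [|n IHn] b a x tm Kx bm mf.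
all: have [gd Vle] := tm; have x0 := golden_gt0 gd.
all: have [lt|le] := ltnP m.+1 (b + 2 * a).
- rewrite (golden_dgap gd bm lt) -EFinM lee_fin expr0 mul1r /level ler_pM2r //.
  have : m.+2%:R <= (b + 2 * a)%:R :> R by rewrite ler_nat.
  by rewrite -[m.+2]addn1 (natrD _ b) natrM (natrD _ m.+1); lra.
- have [gd' _] := tame_next tm.
  rewrite /= in mf.
  rewrite (golden_dgap gd'); [|lia|lia].
  rewrite -EFinM lee_fin expr0 mul1r /= (levelE gd).
  have := golden_sum gd'.
  (* One index early, the value is the next level minus [psi x]: a deficit of about [2 psi x], more
     than the current one, about [x]. *)
  have mR : m.+1%:R <= 2 * b%:R + 3 * a%:R - 2 :> R.
    rewrite lerBrDr -!natrM -!natrD ler_nat; lia.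
  have V1 : `|a%:R - (1 + psi) * b%:R| <= 1 / 2 by lra.
  have : m.+1%:R * (psi * x) <= (2 * b%:R + 3 * a%:R - 2) * (psi * x).
    by rewrite ler_pM2r // mulr_gt0 //; lra.
  move=> /le_trans + _; apply.
  have -> : (2 * b%:R + 3 * a%:R - 2) * (psi * x) =
      level a (b + a) (psi * x) - psi * x by rewrite /level natrD; ring.
  rewrite (levelE gd') natrD.
  have -> : b%:R + a%:R - (1 + psi) * a%:R = - psi * (a%:R - (1 + psi) * b%:R).
    have : psi * psi * b%:R = (1 - psi) * b%:R by rewrite pp.
    by lra.
  move: V1; rewrite ler_norml; move: (_ - (1 + psi) * _) => V /andP[V1 V2].
  rewrite -addrA lerD2l -opprD lerN2.
  have -> : (1 - (3 - 4 * psi) / 5 * (- psi * V)) * (psi * x) + psi * x =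
    ((1 - (3 - 4 * psi) / 5 * (- psi * V)) * psi + psi) * x by ring.
  have [c0 c1] : 0 <= (3 - 4 * psi) / 5 /\ (3 - 4 * psi) / 5 <= 1 / 5 by split; lra.
  rewrite ler_pM2r // mulrCA.
  have : `|(3 - 4 * psi) / 5 * V| <= 1 / 10 by rewrite ler_norml; apply/andP; split; nra.
  by rewrite ler_norml; move: (_ * V) => u /andP[u1 u2]; nra.
- rewrite (golden_dgap gd bm lt).
  apply: le_trans (_ : (level b a x)%:E <= _)%E; last first.
    by rewrite lee_fin; exact: level_fib_ge tm Kx.
  rewrite -EFinM lee_fin /level ler_pM2r //.
  have : m.+2%:R <= (b + 2 * a)%:R :> R by rewrite ler_nat.
  by rewrite -[m.+2]addn1 (natrD _ b) natrM (natrD _ m.+1); lra.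
- rewrite exprSr -mulrA; apply: IHn (tame_next tm) _ _ mf; last by lia.
  by nra.
Qed.

(* [3 a + 2 b] is the next time after which the gap shrinks. Put [w], [v] for
   the variation of [W = a + b psi = 1 / x] and of its conjugate. Then [w v] is
   an integer; if nonzero, the smallness of [v] forces [w] to be large. *)
Lemma level_lt theta theta' K b a x b' a' x' :
  tame theta K b a x -> tame theta' K b' a' x' -> 1 <= K -> 18 * K * K * x < 1 ->
  (2 * b + 3 * a <= 2 * b' + 3 * a')%N ->
  (b = b' /\ a = a') \/ level b a x < level b' a' x'.
Proof.
move=> [gd Vle] [gd' Vle'] K1 Kx le.
have /andP[pl pu] := psi_bounds R; have pp := psi_sqr R.
have sumE := golden_sum gd; have sumE' := golden_sum gd'.
have x0 := golden_gt0 gd; have x0' := golden_gt0 gd'.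
pose D : int := a'%:Z - a%:Z; pose B : int := b'%:Z - b%:Z.
have [n0|n0] := eqVneq (D * D - D * B - B * B) 0.
  by left; have [] := golden_norm_eq0 n0; rewrite /D /B; lia.
right; rewrite (levelE gd) (levelE gd') ltrD2l ltrN2.
have normE := golden_normE R D B.
have norm1 : 1 <= `|(D * D - D * B - B * B)%:~R : R|.
  by rewrite -intr_norm ler1z -gtz0_ge1 normr_gt0.
rewrite -normE normrM /D /B !rmorphB /= -!pmulrn in norm1.
have leR : 2 * b%:R + 3 * a%:R <= 2 * b'%:R + 3 * a'%:R :> R.
  by rewrite -!natrM -!natrD ler_nat.
set W := a%:R + b%:R * psi in sumE.
set W' := a'%:R + b'%:R * psi in sumE'.
set V := a%:R - (1 + psi) * b%:R in Vle *.
set V' := a'%:R - (1 + psi) * b'%:R in Vle' *.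
have wE : a'%:R - a%:R + (b'%:R - b%:R) * psi = W' - W by rewrite /W /W'; ring.
have vE : a'%:R - a%:R - (1 + psi) * (b'%:R - b%:R) = V' - V by rewrite /V /V'; ring.
rewrite wE vE in norm1.
(* The order of the next jumps, in terms of [w] and [v]: it keeps [w] above [-|v|]. *)
have wv : (2 - 3 * psi) * (V' - V) <= (5 + 3 * psi) * (W' - W).
  rewrite -subr_ge0.
  have -> : (5 + 3 * psi) * (W' - W) - (2 - 3 * psi) * (V' - V) =
    (1 + 2 * psi) * (2 * b'%:R + 3 * a'%:R - (2 * b%:R + 3 * a%:R)).
    have ppz (z : R) : psi * psi * z = z - psi * z by rewrite pp mulrBl mul1r.
    have := ppz b%:R; have := ppz b'%:R; have := ppz a%:R; have := ppz a'%:R.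
    by rewrite /V /V' /W /W'; lra.
  by rewrite mulr_ge0 //; lra.
have W'1 : 1 <= W'.
  have : 1 <= a'%:R :> R by rewrite ler1n (golden_pos gd').
  by have := ler0n R b'; rewrite /W'; nra.
clearbody W W' V V'; clear D B n0 normE wE vE leR.
have W0 : 0 < W by rewrite -(pmulr_lgt0 _ x0) sumE.
have W18 : 18 * K * K < W.
  by rewrite -(ltr_pM2r x0) sumE.
have K0 : 0 < K by lra.
have KK : K <= K * K by rewrite ler_peMl //; lra.
have x'1 : x' <= 1 by nra.
have Kx18 : 18 * K * x < 1.
  have : K * x <= K * K * x by rewrite ler_pM2r.
  by lra.
have vle : `|V' - V| <= K * x + K * x'.
  by apply: le_trans (ler_normB _ _) _; lra.
have wge : - `|V' - V| <= W' - W.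
  have /andP[vl vu] : - `|V' - V| <= V' - V <= `|V' - V| by rewrite -ler_norml.
  have u0 := normr_ge0 (V' - V); rewrite leNgt; apply/negP => wlt.
  have h1 : 5 * (W' - W) + 3 * (psi * (W' - W)) < - 5 * `|V' - V|.
    suff : 0 <= psi * (W - W') by lra.
    by rewrite mulr_ge0; lra.
  have h2 : - `|V' - V| <= (2 - 3 * psi) * (V' - V) by nra.
  by lra.
have Kx' : K * x' <= K by rewrite ger_pMr.
have W2 : W <= 2 * W' by lra.
have x'2 : x' <= 2 * x.
  have : W * (x * x') <= 2 * W' * (x * x') by rewrite ler_pM2r // mulr_gt0.
  have -> : W * (x * x') = W * x * x' by ring.
  have -> : 2 * W' * (x * x') = 2 * (W' * x') * x by ring.
  by rewrite sumE sumE'; lra.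
have v3 : `|V' - V| <= 3 * K * x.
  have : K * x' <= K * (2 * x) by rewrite ler_pM2l.
  by lra.
have v0 := normr_ge0 (V' - V).
have w0 : 0 < W' - W.
  rewrite ltNge; apply/negP => w0.
  have : `|W' - W| <= 1 / 2 by rewrite ler0_norm //; lra.
  have : `|V' - V| <= 1 / 2 by lra.
  by have := normr_ge0 (W' - W); nra.
rewrite gtr0_norm // in norm1.
have wK : W <= (W' - W) * (3 * K).
  have h : 1 <= (W' - W) * (3 * K * x).
    by apply: le_trans norm1 _; rewrite ler_pM2l.
  have := ler_wpM2l (ltW W0) h.
  have -> : W * ((W' - W) * (3 * K * x)) = W * x * ((W' - W) * (3 * K)) by ring.
  by rewrite sumE; lra.
(* Origin of the constant 18: [W > 18 K^2] and [W <= 3 K w] give [w > 6 K], and [w / 2 > 3 K]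
   absorbs the conjugate terms. *)
have w6 : 6 * K < W' - W.
  have : 6 * K * (3 * K) < (W' - W) * (3 * K) by lra.
  by rewrite ltr_pM2r //; lra.
set c := (3 - 4 * psi) / 5.
have c0 : 0 < c by rewrite /c; lra.
have c1 : c < 1 by rewrite /c; lra.
have cle (z : R) : c * z <= `|z|.
  by apply: le_trans (ler_norm _) _; rewrite normrM gtr0_norm // ler_piMl // ltW.
have cV : c * V <= K * x by exact: le_trans (cle V) Vle.
have cV' : - (c * V') <= 2 * K * x.
  have : K * x' <= K * (2 * x) by rewrite ler_pM2l.
  by have := cle (- V'); rewrite normrN mulrN; lra.
have WW : 0 < W * W' by rewrite mulr_gt0 //; lra.
rewrite -(ltr_pM2r WW).
have -> : (1 - c * V') * x' * (W * W') = (1 - c * V') * W * (W' * x') by ring.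
have -> : (1 - c * V) * x * (W * W') = (1 - c * V) * W' * (W * x) by ring.
rewrite sumE sumE' !mulr1.
have l1 : (1 - c * V') * W <= W + 2 * K.
  have : (1 - c * V') * W <= (1 + 2 * K * x) * W by rewrite ler_pM2r //; lra.
  have -> : (1 + 2 * K * x) * W = W + 2 * K * (W * x) by ring.
  by rewrite sumE mulr1.
apply: le_lt_trans l1 _.
have l2 : (1 - K * x) * W' <= (1 - c * V) * W' by rewrite ler_pM2r //; lra.
apply: lt_le_trans l2.
have -> : (1 - K * x) * W' = W - K * (W * x) + (1 - K * x) * (W' - W) by ring.
rewrite sumE mulr1.
have : 1 / 2 * (W' - W) <= (1 - K * x) * (W' - W) by rewrite ler_pM2r //; lra.
by lra.
Qed.

(** The denominators determine [x], so the [q0] and [q1] multiples of [theta] and [theta'] agree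
    modulo 1 up to a common sign; the unit determinant transfers this to [theta] and [theta']. *)
Lemma golden_equiv theta theta' q0 q1 x x' :
  golden theta q0 q1 x -> golden theta' q0 q1 x' ->
  theta - theta' \is a Num.int \/ theta + theta' \is a Num.int.
Proof.
move=> gd gd'; have xx : x' = x.
  have s := golden_sum gd; have s' := golden_sum gd'.
  have W0 : q1%:R + q0%:R * psi != 0.
    by apply/eqP => W0; move/eqP: s; rewrite W0 mul0r eq_sym oner_eq0.
  by apply: (mulfI W0); rewrite s s'.
move: gd gd' => [p0 [p1 [e br]]] [p0' [p1' [e' br']]]; rewrite xx in br'.
have det : q0%:R * p1%:~R - q1%:R * p0%:~R = e%:~R :> R.
  by rewrite -(bracket_det br) rmorphB /= !rmorphM /= -!pmulrn.
have e1 := bracket_x0 br; have e2 := bracket_x1 br.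
have e1' := bracket_x0 br'; have e2' := bracket_x1 br'.
have combine (t : R) (c0 c1 : int) : q0%:R * t = c0%:~R -> q1%:R * t = c1%:~R ->
    t \is a Num.int.
  move=> h0 h1; apply/intrP; exists (e * (p1 * c0 - p0 * c1)).
  rewrite rmorphM rmorphB /= !rmorphM /= -h0 -h1.
  have -> : p1%:~R * (q0%:R * t) - p0%:~R * (q1%:R * t) = 
    (q0%:R * p1%:~R - q1%:R * p0%:~R) * t by ring.
  rewrite det; case: (bracket_sign br) => ->; rewrite ?mulrN1z ?mulr1z; ring.
have [es|es] := bracket_sign br; have [es'|es'] := bracket_sign br';
  rewrite es ?mulrN1z ?mulr1z in e1 e2; rewrite es' ?mulrN1z ?mulr1z in e1' e2'.
- left; apply: (combine _ (p0 - p0') (p1 - p1')); rewrite rmorphB /=; lra.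
- right; apply: (combine _ (p0 + p0') (p1 + p1')); rewrite rmorphD /=; lra.
- right; apply: (combine _ (p0 + p0') (p1 + p1')); rewrite rmorphD /=; lra.
- left; apply: (combine _ (p0 - p0') (p1 - p1')); rewrite rmorphB /=; lra.
Qed.

End Levels.

(** * Comparison of the partial maxima *)

Section Argmin.
Variable R : realType.
Local Notation psi := (psi R).

Lemma psi_expr_lt (c eps : R) : 0 <= c -> 0 < eps ->
  exists n0, forall n, (n0 <= n)%N -> c * psi ^+ n < eps.
Proof.
move=> c0 eps0; have /andP[pl pu] := psi_bounds R.
exists (Num.bound (2 * c / eps)) => n nb.
have nE : 2 * c < n%:R * eps.
  rewrite -ltr_pdivrMr //; apply: lt_le_trans (_ : (Num.bound (2 * c / eps))%:R <= _).
    by apply: archi_boundP; rewrite divr_ge0 ?mulr_ge0 // ltW.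
  by rewrite ler_nat.
have := psi_expr_le R n.
have pn : 0 < psi ^+ n by rewrite exprn_gt0 //; lra.
have n0 := ler0n R n; move: (psi ^+ n) (n%:R) n0 pn nE => u v v0 u0 nE uv.
have uv2 : u * v <= 2 by nra.
have n1 : 0 < v by rewrite lt0r v0 andbT; apply/eqP => vz; rewrite vz in nE; lra.
rewrite -(ltr_pM2r n1).
have := ler_wpM2l c0 uv2; lra.
Qed.

Lemma exists_switch (f : nat -> nat) T : (f 0 < T)%N -> (forall j, j <= f j)%N ->
  exists j, (f j < T <= f j.+1)%N.
Proof.
move=> f0 fj; have ex : exists j, (T <= f j)%N by exists T.
case: (ex_minnP ex) => [[|j]] Tj jmin; first by lia.
by exists j; rewrite Tj andbT ltnNge; apply/negP => /jmin; rewrite ltnn.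
Qed.

Lemma Dmax_le (theta : R) M (y : \bar R) :
  (forall m, (0 < m <= M)%N -> m.+1%:R%:E * dgap theta m <= y)%E ->
  (Dmax M theta <= y)%E.
Proof.
move=> le; rewrite /Dmax big_seq; apply: bigmax_le => [|m]; first exact: leNye.
by rewrite mem_index_iota ltnS => mM; exact: le.
Qed.

Lemma Dmax_ge (theta : R) M m : (0 < m <= M)%N ->
  (m.+1%:R%:E * dgap theta m <= Dmax M theta)%E.
Proof.
move=> mM; rewrite /Dmax.
apply: (@le_bigmax_seq _ _ _ _ -oo%E m xpredT (fun m => m.+1%:R%:E * dgap theta m)%E) => //.
by rewrite mem_index_iota ltnS.
Qed.

(** Picks the last level reached before index [F - 2]; the next one comes at [F - 2] or later. *)
Lemma exists_last_level (theta K x : R) q0 q1 F :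
  tame theta K q0 q1 x -> (3 <= q0 + 2 * q1 < F)%N -> exists b a y, tame theta K b a y /\
    [/\ (3 <= b + 2 * a)%N, (b + 2 * a < F)%N & (F <= 2 * b + 3 * a)%N].
Proof.
move=> tm /andP[q3 qF]; have [gd _] := tm; have q1gt := golden_pos gd.
have [j /andP[jF Fj]] : exists j, (fib q0 q1 j.+3 < F <= fib q0 q1 j.+4)%N.
  apply: (@exists_switch (fun j => fib q0 q1 j.+3)) => [|j].
    by rewrite /= addnA [(q1 + q0)%N]addnC -addnA addnn -mul2n.
  apply: leq_trans (leq_trans (leqnSn _) (leqnSn _)) (fib_ge q0 j.+2 q1gt).
exists (fib q0 q1 j), (fib q0 q1 j.+1), (psi ^+ j * x).
split; first exact: tame_fib.
have jge : (3 <= fib q0 q1 j + 2 * fib q0 q1 j.+1)%N.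
  case: (j) => [//|k]; have := fib_gt0 q0 k q1gt; have := fib_gt0 q0 k.+1 q1gt.
  by move: (fib q0 q1 k.+1) (fib q0 q1 k.+2) => b a; clear; lia.
move: jF Fj jge; rewrite !fibSS; clear.
by move: (fib q0 q1 j) (fib q0 q1 j.+1) => b a; split; lia.
Qed.

Lemma level_le_Dmax (theta x : R) b a M : golden theta b a x ->
  (3 <= b + 2 * a)%N -> (b + 2 * a <= M.+2)%N -> ((level b a x)%:E <= Dmax M theta)%E.
Proof.
move=> gd ba3 baM; have agt := golden_pos gd.
have mM : (0 < b + 2 * a - 2 <= M)%N by clear gd; lia.
apply: le_trans (Dmax_ge theta mM).
have -> : dgap theta (b + 2 * a - 2) = x%:E.
  by apply: (golden_dgap gd); clear gd; lia.
have -> : (b + 2 * a - 2).+1 = (b + 2 * a - 1)%N by clear gd; lia.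
by rewrite -EFinM lee_fin natrB; [rewrite natrD natrM | clear gd; lia].
Qed.

End Argmin.

Theorem mainTheorem3 (R : realType) (theta0 : R)
    (htheta0 : optimal_set theta0) :
  infinite_set [set M : nat | (0 < M)%N /\
    forall theta : R, optimal_set theta ->
      theta - theta0 \isn't a Num.int -> theta + theta0 \isn't a Num.int ->
      (Dmax M theta0 < Dmax M theta)%E].
Proof.
have /andP[pl pu] := psi_bounds R.
set A := [set M : nat | _].
suff large : forall B, exists2 M, (B <= M)%N & A M.
  move=> /finite_fsetP[X AX].
  have [M BM AM] := large (\sum_(i <- finmap.enum_fset X) i).+1.
  have : M \in finmap.enum_fset X by rewrite AX in AM.
  by move=> MX; rewrite (big_rem M) //= in BM; lia.
move=> B.
have [K K1 otame] := optimal_tame R.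
have [b0 [a0 [x0 [tm0 _]]]] := otame _ htheta0.
have x0gt : 0 < x0 by have [gd _] := tm0; exact: golden_gt0 gd.
have [s sP] := @psi_expr_lt R (2 * K * x0) 1 (ltac:(nra)) ltr01.
have := tame_fib s tm0; have := sP s (leqnn s).
move: (fib b0 a0 s) (fib b0 a0 s.+1) => b a xlt tm.
have Kx : 2 * K * (psi R ^+ s * x0) <= 1 by lra.
move: (psi R ^+ s * x0) tm Kx => x tm Kx {xlt sP s tm0 x0gt x0 a0 b0}.
have [gd _] := tm; have xgt := golden_gt0 gd; have agt := golden_pos gd.
have [eps eps0 small] := optimal_strict_unif (b + a) htheta0.
have [n1 n1P] := @psi_expr_lt R (18 * K * K * x) 1 (ltac:(nra)) ltr01.
have [n2 n2P] := @psi_expr_lt R (2 * x) eps (ltac:(lra)) eps0.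
(* [n1] serves [level_lt], [n2] the early indices, and 40 bounds [q0 + 2 q1] for the starting
   bracket of any optimal [theta]. *)
have [n [n1n n2n nB]] : exists n, [/\ (n1 <= n)%N, (n2 <= n)%N & (B + 40 <= n)%N].
  by exists (n1 + n2 + B + 40)%N; split; lia.
have {n1P}n1n := n1P n n1n; have {n2P}n2n := n2P n n2n.
have nF := fib_ge b n.+3 agt.
have [F [FE F4 Fm]] : exists F, [/\ (n.+3 <= F)%N,
    F = (2 * fib b a n + 3 * fib b a n.+1)%N & forall m, (m.+2 < F)%N ->
    (b + a <= m.+1)%N -> (m.+1%:R%:E * dgap theta0 m <=
    (level (fib b a n) (fib b a n.+1) (psi R ^+ n * x))%:E)%E].
  exists (fib b a n.+4); split=> [//||m mF bam]; first by rewrite !fibSS; lia.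
  exact: dgap_le_level tm Kx bam mF.
move: {nF} F FE F4 Fm => F nF F4 Fm.
(* The last index before [theta0] reaches its next level, at [F - 2]. *)
exists (F - 3)%N; first by lia.
split=> [|theta opt dif sum]; first by lia.
have tmn := tame_fib n tm; have [gdn Vn] := tmn.
have xn := golden_gt0 gdn.
have Kxn : 18 * K * K * (psi R ^+ n * x) < 1 by lra.
have Kxn1 : K * (psi R ^+ n * x) <= K * K * (psi R ^+ n * x).
  by rewrite ler_pM2r // ler_peMl //; lra.
have upper : (Dmax (F - 3) theta0 <=
    (level (fib b a n) (fib b a n.+1) (psi R ^+ n * x))%:E)%E.
  apply: Dmax_le => m /andP[m0 mM].
  have [lt|le] := ltnP m.+1 (b + a); last first.
    by apply: Fm le; clear - mM nF; lia.
  (* Early values stay [eps] below the optimal value, whereas the deficit of the level is at most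
     [2 psi^n x < eps]. *)
  apply: le_trans (small m _) _; first by rewrite m0; clear - lt; lia.
  rewrite lee_fin (levelE gdn) lerD2l lerN2.
  have V1 : `|(fib b a n.+1)%:R - (1 + psi R) * (fib b a n)%:R| <= 1.
    by apply: le_trans Vn _; lra.
  apply: (@le_trans _ _ (2 * (psi R ^+ n * x))); last by lra.
  rewrite ler_pM2r //; move: V1; rewrite ler_norml; move: (_ - (1 + psi R) * _) => V /andP[V1 V2].
  by nra.
apply: le_lt_trans upper _.
have [q0 [q1 [x' [tm' q20]]]] := otame _ opt.
have qF : (3 <= q0 + 2 * q1 < F)%N by clear - q20 nB nF; lia.
have [b' [a' [y [tmy [ba3 baF Fba]]]]] := exists_last_level tm' qF.
have [gdy _] := tmy.
have baF2 : (b' + 2 * a' <= (F - 3).+2)%N by clear - baF nF; lia.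
apply: lt_le_trans (level_le_Dmax gdy ba3 baF2); rewrite lte_fin.
(* The next jump of [theta] is no earlier than that of [theta0], so its level is higher unless the
   denominators coincide, which [golden_equiv] rules out. *)
rewrite F4 in Fba; have [[bb aa]|//] := level_lt tmn tmy K1 Kxn Fba.
rewrite -bb -aa in gdy.
by case: (golden_equiv gdy gdn) => h; move: dif sum; rewrite h.
Qed.
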